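(* Let $n\geq 1$ and let $w\in F_n$ be a word in the free generators $x_1,\dots,x_n$. Then $w$ satisfies the local to global property in $F_k$ for every $k\geq 1$ if and only if $w$ satisfies the local to global property in $F_k$ for every $k\leq n$.
   Context: For a residually finite group $G$, its profinite completion $\hat G$ is the closure of the image of the (injective) diagonal map $G\to\prod_{i}H_i$, $g\mapsto(\pi_i(g))_i$, where $\pi_i:G\to H_i$ ranges over all surjections onto finite groups, each $H_i$ discrete and the product carrying the product topology; $G$ is identified with a dense subgroup of $\hat G$. Free groups are residually finite. For a word $w\in F_n$ and elements $a_1,\dots,a_n$ of a group $\Gamma$, $w(a_1,\dots,a_n)$ denotes the image of $w$ under the homomorphism $F_n\to\Gamma$, $x_i\mapsto a_i$. We say that $w$ satisfies the local to global property in $F_k$ if for every $g\in F_k$: there exist $\hat g_1,\dots,\hat g_n\in\hat F_k$ with $w(\hat g_1,\dots,\hat g_n)=g$ if and only if there exist $g_1,\dots,g_n\in F_k$ with $w(g_1,\dots,g_n)=g$. *)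

(* Defs.v *)
(* Free groups F_k as reduced words; profinite completion
   as the closure of the diagonal image in the product over all surjections
   onto finite groups. *)
From Stdlib Require List.
From mathcomp Require Import all_boot all_fingroup.
Set Implicit Arguments. Unset Strict Implicit. Unset Printing Implicit Defensive.
Local Open Scope group_scope.

(* A letter of F_k: (i, false) = x_i, (i, true) = x_i^-1. *)
Definition letter (k : nat) := ('I_k * bool)%type.

Definition canc {k} (a b : letter k) : bool := (a.1 == b.1) && (a.2 != b.2).

Definition red_cons {k} (l : letter k) (s : seq (letter k)) : seq (letter k) :=
  match s with
  | l' :: s' => if canc l l' then s' else l :: s
  | [::] => [:: l]
  end.

Definition reduce {k} (s : seq (letter k)) : seq (letter k) := foldr red_cons [::] s.

Definition reduced {k} (s : seq (letter k)) : bool :=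
  sorted (fun a b => ~~ canc a b) s.

Lemma red_cons_reduced k (l : letter k) s : reduced s -> reduced (red_cons l s).
Proof.
case: s => [|l' s'] //= Hs.
case: ifP => Hc; first by move: Hs; rewrite /reduced /=; apply: path_sorted.
by rewrite /reduced /= Hc.
Qed.

Lemma reduce_reduced k (s : seq (letter k)) : reduced (reduce s).
Proof. by elim: s => [|l s IH] //=; apply: red_cons_reduced. Qed.

Definition FG (k : nat) := {s : seq (letter k) | reduced s}.

Definition FG_one {k} : FG k := exist _ [::] (isT : reduced [::]).
Definition FG_mul {k} (x y : FG k) : FG k :=
  exist _ (reduce (val x ++ val y)) (reduce_reduced _).
Definition FG_inv {k} (x : FG k) : FG k :=
  exist _ (reduce (rev (map (fun l : letter k => (l.1, ~~ l.2)) (val x))))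
    (reduce_reduced _).

Definition feval {n k} (a : 'I_n -> FG k) (w : FG n) : FG k :=
  foldr (fun (l : letter n) acc =>
           FG_mul (if l.2 then FG_inv (a l.1) else a l.1) acc) FG_one (val w).

Definition geval {n} (gT : finGroupType) (a : 'I_n -> gT) (w : FG n) : gT :=
  foldr (fun (l : letter n) acc =>
           (if l.2 then (a l.1)^-1 else a l.1) * acc) 1 (val w).

Definition is_surj_hom {k} (gT : finGroupType) (f : FG k -> gT) : Prop :=
  (forall x y, f (FG_mul x y) = f x * f y) /\ (forall h : gT, exists g, f g = h).

Definition Idx (k : nat) :=
  { gT : finGroupType & { f : FG k -> gT | is_surj_hom f } }.

Definition Htgt {k} (i : Idx k) : finGroupType := projT1 i.
Definition proj {k} (i : Idx k) : FG k -> Htgt i := sval (projT2 i).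

Definition Prod (k : nat) := forall i : Idx k, Htgt i.

Definition diag {k} (g : FG k) : Prod k := fun i => proj i g.

(* x lies in the closure of the diagonal image (product topology, discrete
   factors): every basic open neighbourhood, determined by finitely many
   coordinates, meets the image of F_k. *)
Definition in_hat {k} (x : Prod k) : Prop :=
  forall S : list (Idx k), exists g : FG k,
    forall i, List.In i S -> proj i g = x i.

Definition peval {n k} (xs : 'I_n -> Prod k) (w : FG n) : Prod k :=
  fun i => geval (fun j => xs j i) w.

Definition local_to_global {n} (w : FG n) (k : nat) : Prop :=
  forall g : FG k,
    (exists xs : 'I_n -> Prod k, (forall j, in_hat (xs j)) /\
        (forall i, peval xs w i = diag g i))
    <-> (exists gs : 'I_n -> FG k, feval gs w = g).

(* Main.v *)
(* Let [w(x) = g] in the profinite completion of [F_k], with [g] in [F_k].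
   For a finite quotient [Q] of [F_k] let [H] be the subgroup of [Q] generated
   by the images of the [x_j]; the word [g] traces a closed path in the Schreier
   graph of [H] in [Q].  Refining [Q] can only separate the vertices of this
   path, so one may take [Q] such that the next refinement does not separate
   them any further.  The traced graph has a free fundamental group [A] of some
   rank [m], a free factor of the preimage [J] of [H] in [F_k].  The retraction
   of [J] onto [A] fixes [g] and carries the [x_j] to a solution of
   [w(y) = g] in the completion of [A].  By stability [A] still lies in the
   preimage of the group generated by the [x_j] in the refined quotient, so the
   [x_j] generate the elementary abelian 2-quotient of [A], whence [m <= n], and
   the hypothesis applies in [A], a free group of rank [m]. *)
From HB Require Import structures.
Require Import Defs.
From mathcomp Require Import all_boot all_fingroup.
From mathcomp Require Import ssralg zmodp matrix mxalgebra.
Set Implicit Arguments.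
Unset Strict Implicit.
Unset Printing Implicit Defensive.

(** * Free groups *)

Section MultiplicativeMaps.
Local Open Scope group_scope.
Variables (G H : groupType) (f : G -> H).
Hypothesis fM : {morph f : x y / x * y}.

Lemma mulmap1 : f 1 = 1.
Proof. by apply: (mulgI (f 1)); rewrite -fM !mulg1. Qed.

Lemma mulmapV x : f x^-1 = (f x)^-1.
Proof. by apply: (mulgI (f x)); rewrite -fM !mulgV mulmap1. Qed.

End MultiplicativeMaps.

Section Words.
Local Open Scope group_scope.
Variable k : nat.
Implicit Types (l : letter k) (s t : seq (letter k)).

Definition letter_inv l : letter k := (l.1, ~~ l.2).
Definition word_inv s := rev (map letter_inv s).

Lemma letter_invK : involutive letter_inv.
Proof. by case=> i b; rewrite /letter_inv /= negbK. Qed.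

Lemma word_invK : involutive word_inv.
Proof.
move=> s; rewrite /word_inv map_rev revK -map_comp map_id_in // => l _.
exact: letter_invK.
Qed.

Lemma word_inv_cons l s : word_inv (l :: s) = rcons (word_inv s) (letter_inv l).
Proof. by rewrite /word_inv /= rev_cons. Qed.

Lemma cancE l l' : canc l l' = (l' == letter_inv l).
Proof.
case: l l' => [i b] [j c]; rewrite /canc /letter_inv /= xpair_eqE eq_sym.
by case: b; case: c.
Qed.

Lemma canc_invl l : canc (letter_inv l) l.
Proof. by rewrite cancE letter_invK. Qed.

Lemma red_consK l l' s :
  reduced s -> canc l l' -> red_cons l (red_cons l' s) = s.
Proof.
move=> red_s Hc; case: s red_s => [|b s] /= red_s; first by rewrite Hc.
case: ifP => [|_ /=]; last by rewrite Hc.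
move: Hc; rewrite !cancE => /eqP-> /eqP; rewrite letter_invK => eb.
subst b; case: s red_s => [|c s] //=.
by rewrite /reduced /= => /andP[/negbTE-> _].
Qed.

Lemma foldr_red_cons_reduced s t : reduced t -> reduced (foldr red_cons t s).
Proof. by move=> red_t; elim: s => //= l s; apply: red_cons_reduced. Qed.

Lemma foldr_red_cons_reduce s t :
  reduced t -> foldr red_cons t (reduce s) = foldr red_cons t s.
Proof.
move=> red_t; elim: s => //= l s IHs; rewrite -IHs.
case: (reduce s) => [|l' r] //=; case: ifP => //= Hc.
by rewrite red_consK // foldr_red_cons_reduced.
Qed.

Lemma reduce_id s : reduced s -> reduce s = s.
Proof.
elim: s => //= l s IHs red_s; rewrite IHs; last exact: path_sorted red_s.
by case: s red_s {IHs} => //= l' s; rewrite /reduced /= => /andP[/negbTE->].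
Qed.

Lemma reduce_cat s t : reduce (s ++ t) = foldr red_cons (reduce t) s.
Proof. by rewrite /reduce foldr_cat. Qed.

Lemma reduce_catl s t : reduce (reduce s ++ t) = reduce (s ++ t).
Proof. by rewrite !reduce_cat foldr_red_cons_reduce // reduce_reduced. Qed.

Lemma reduce_catr s t : reduce (s ++ reduce t) = reduce (s ++ t).
Proof. by rewrite !reduce_cat (reduce_id (reduce_reduced t)). Qed.

Lemma reduce_catV s : reduce (word_inv s ++ s) = [::].
Proof.
elim: s => //= l s IHs; rewrite word_inv_cons cat_rcons reduce_cat /=.
by rewrite red_consK ?reduce_reduced ?canc_invl // -reduce_cat.
Qed.

Definition FG_of s : FG k := exist _ (reduce s) (reduce_reduced s).

Lemma FG_ofK (x : FG k) : FG_of (val x) = x.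
Proof. by apply: val_inj; rewrite /= reduce_id //; case: x. Qed.

HB.instance Definition _ := Choice.copy (FG k) {s : seq (letter k) | reduced s}.

Lemma FG_mulA : associative (@FG_mul k).
Proof.
by move=> x y z; apply: val_inj; rewrite /= reduce_catl reduce_catr catA.
Qed.

Lemma FG_mul1 : left_id (@FG_one k) FG_mul.
Proof. by move=> x; apply: val_inj; rewrite /= reduce_id //; case: x. Qed.

Lemma FG_mulr1 : right_id (@FG_one k) FG_mul.
Proof. by move=> x; apply: val_inj; rewrite /= cats0 reduce_id //; case: x. Qed.

Lemma FG_mulV : left_inverse (@FG_one k) FG_inv FG_mul.
Proof. by move=> x; apply: val_inj; rewrite /= reduce_catl reduce_catV. Qed.

Lemma FG_mulrV : right_inverse (@FG_one k) FG_inv FG_mul.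
Proof.
move=> x; apply: val_inj.
by rewrite /= reduce_catr -{1}(word_invK (val x)) reduce_catV.
Qed.

HB.instance Definition _ :=
  isGroup.Build (FG k) FG_mulA FG_mul1 FG_mulr1 FG_mulV FG_mulrV.

Lemma FG_of_cat s t : FG_of (s ++ t) = FG_of s * FG_of t.
Proof. by apply: val_inj; rewrite /= reduce_catl reduce_catr. Qed.

Lemma FG_of_inv s : FG_of (word_inv s) = (FG_of s)^-1.
Proof.
apply: (mulIg (FG_of s)); rewrite mulVg -FG_of_cat.
by apply: val_inj; rewrite /= reduce_catV.
Qed.

Definition FG_gen i : FG k := FG_of [:: (i, false)].

Section Eval.
Variables (G : groupType) (a : 'I_k -> G).

Definition leval l : G := if l.2 then (a l.1)^-1 else a l.1.
Definition weval s : G := foldr (fun l acc => leval l * acc) 1 s.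
Definition FG_hom (x : FG k) : G := weval (val x).

Lemma leval_inv l : leval (letter_inv l) = (leval l)^-1.
Proof. by case: l => i [] //=; rewrite /leval /= invgK. Qed.

Lemma weval_cat s t : weval (s ++ t) = weval s * weval t.
Proof. by elim: s => [|l s IHs] /=; rewrite ?mul1g // IHs mulgA. Qed.

Lemma weval_rcons s l : weval (rcons s l) = weval s * leval l.
Proof. by rewrite -cats1 weval_cat /= mulg1. Qed.

Lemma weval_inv s : weval (word_inv s) = (weval s)^-1.
Proof.
elim: s => [|l s IHs] /=; first by rewrite invg1.
by rewrite word_inv_cons weval_rcons IHs leval_inv invgM.
Qed.

Lemma weval_reduce s : weval (reduce s) = weval s.
Proof.
elim: s => //= l s <-; case: (reduce s) => //= l' t.
by case: ifP => //; rewrite cancE => /eqP->; rewrite leval_inv mulKVg.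
Qed.

Lemma FG_homM x y : FG_hom (x * y) = FG_hom x * FG_hom y.
Proof. by rewrite /FG_hom /= weval_reduce weval_cat. Qed.

Lemma FG_hom_of s : FG_hom (FG_of s) = weval s.
Proof. exact: weval_reduce. Qed.

End Eval.

Lemma weval_gen s : weval FG_gen s = FG_of s.
Proof.
elim: s => /= [|l s IHs]; first exact: val_inj.
by rewrite IHs -cat1s FG_of_cat; congr (_ * _); case: l => i [].
Qed.

Lemma weval_morph (G H : groupType) (a : 'I_k -> G) (f : G -> H) :
  {morph f : x y / x * y} -> forall s, f (weval a s) = weval (f \o a) s.
Proof.
move=> fM; have f1 := mulmap1 fM.
have fV := mulmapV fM.
by elim=> //= l s IHs; rewrite fM IHs /leval; case: l.2; rewrite //= fV.
Qed.

Lemma eq_weval (G : groupType) (a b : 'I_k -> G) : a =1 b -> weval a =1 weval b.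
Proof. by move=> eab; elim=> //= l s ->; rewrite /leval eab. Qed.

Lemma eq_FG_hom (G : groupType) (a b : 'I_k -> G) x :
  a =1 b -> FG_hom a x = FG_hom b x.
Proof. by move=> eab; apply: eq_weval. Qed.

Lemma FG_hom_comp (G H : groupType) (a : 'I_k -> G) (f : G -> H) x :
  {morph f : x y / x * y} -> f (FG_hom a x) = FG_hom (f \o a) x.
Proof. by move=> fM; rewrite /FG_hom weval_morph. Qed.

End Words.

Lemma fevalE n k (a : 'I_n -> FG k) w : feval a w = FG_hom a w.
Proof. by []. Qed.

Lemma gevalE n (gT : finGroupType) (a : 'I_n -> gT) w : geval a w = FG_hom a w.
Proof. by []. Qed.

(** * Edge labellings of Schreier graphs *)

Section Labels.
Local Open Scope group_scope.
Variables (k : nat) (gT : finGroupType) (a : 'I_k -> gT).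
Implicit Types (v : {set gT}) (l : letter k) (s : seq (letter k)).

(** An edge is named by its source and its generator. An inverse letter runs backwards along the
    edge that starts where the letter leads, so both directions yield the same name. Vertices are
    plain subsets under right translation. *)
Definition edge v l : {set gT} * 'I_k :=
  (if l.2 then v :* leval a l else v, l.1).

Fixpoint edges v s : seq ({set gT} * 'I_k) :=
  if s is l :: s' then edge v l :: edges (v :* leval a l) s' else [::].

Lemma edges_cat v s t :
  edges v (s ++ t) = edges v s ++ edges (v :* weval a s) t.
Proof.
elim: s v => [|l s IHs] v /=; first by rewrite mulg1.
by rewrite IHs rcosetM.
Qed.

Section Lab.
Variables (G : groupType) (lam : {set gT} -> 'I_k -> G).

Definition llab v l :=
  if l.2 then (lam (v :* leval a l) l.1)^-1 else lam v l.1.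

Fixpoint lab v s : G :=
  if s is l :: s' then llab v l * lab (v :* leval a l) s' else 1.

Lemma llab_inv v l : llab (v :* leval a l) (letter_inv l) = (llab v l)^-1.
Proof.
rewrite /llab leval_inv -rcosetM mulgV mulg1 /=.
by case: l => i [] /=; rewrite ?invgK.
Qed.

Lemma lab_cat v s t : lab v (s ++ t) = lab v s * lab (v :* weval a s) t.
Proof.
elim: s v => [|l s IHs] v /=; first by rewrite mulg1 mul1g.
by rewrite IHs rcosetM mulgA.
Qed.

Lemma lab_reduce v s : lab v (reduce s) = lab v s.
Proof.
elim: s v => //= l s IHs v; rewrite -IHs; case: (reduce s) => //= l' t.
case: ifP => //; rewrite cancE => /eqP->.
by rewrite llab_inv leval_inv mulKVg -rcosetM mulgV mulg1.
Qed.

Lemma lab_inv v s : lab (v :* weval a s) (word_inv s) = (lab v s)^-1.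
Proof.
apply: (mulgI (lab v s)); rewrite -lab_cat mulgV -lab_reduce.
by rewrite -{1}(word_invK s) reduce_catV.
Qed.

(** Labels always multiply along paths; when every path involved returns to [v], they can all be
    read from [v], and [lab v] acts as a homomorphism. *)
Lemma lab_FG_hom v n (h : 'I_n -> FG k) w :
  (forall j, v :* FG_hom a (h j) = v) ->
  lab v (val (FG_hom h w)) = FG_hom (fun j => lab v (val (h j))) w.
Proof.
move=> hv; rewrite /FG_hom; elim: (val w) => //= l s IHs.
rewrite lab_reduce lab_cat; set x := leval h l.
have [-> ->]: v :* weval a (val x) = v /\
    lab v (val x) = leval (fun j => lab v (val (h j))) l.
  rewrite {}/x /leval; case: l => i [] /=; last by split=> //; exact: hv.
  rewrite lab_reduce weval_reduce weval_inv -/(FG_hom a (h i)); split.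
    by rewrite -{1}(hv i) -rcosetM mulgV mulg1.
  by rewrite -{1}(hv i) lab_inv.
by rewrite IHs.
Qed.

Lemma lab_eq1 v s :
  (forall u i, (u, i) \in edges v s -> lam u i = 1) -> lab v s = 1.
Proof.
elim: s v => //= l s IHs v H.
rewrite IHs => [|u i us]; last by rewrite H // inE us orbT.
rewrite mulg1 /llab; have := H (edge v l).1 (edge v l).2.
by rewrite mem_head /edge /=; case: l.2 => ->; rewrite ?invg1.
Qed.

(* A labelling [t(v) x_i t(v x_i)^-1] is a coboundary. *)
Lemma lab_telescope (H : groupType) (b : 'I_k -> H) (f : G -> H)
    (t : {set gT} -> H) v s :
  {morph f : x y / x * y} ->
  (forall u i, (u, i) \in edges v s ->
    f (lam u i) = t u * b i * (t (u :* a i))^-1) ->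
  f (lab v s) = t v * weval b s * (t (v :* weval a s))^-1.
Proof.
move=> fM; have f1 := mulmap1 fM.
have fV := mulmapV fM.
elim: s v => [|l s IHs] v H1 /=; first by rewrite f1 !mulg1 mulgV.
have Hs u i: (u, i) \in edges (v :* leval a l) s ->
    f (lam u i) = t u * b i * (t (u :* a i))^-1.
  by move=> us; rewrite H1 // inE us orbT.
have: f (llab v l) = t v * leval b l * (t (v :* leval a l))^-1.
  move: (H1 (edge v l).1 (edge v l).2); rewrite mem_head => /(_ isT).
  rewrite /edge /llab /leval; case: l {H1 Hs} => i [] //= E.
  by rewrite fV E -rcosetM mulVg mulg1 !invgM invgK mulgA.
by rewrite fM (IHs _ Hs) rcosetM => ->; rewrite !mulgA mulgKV.
Qed.

End Lab.

Section LabPerm.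
Variables (G : finGroupType) (lam : {set gT} -> 'I_k -> G).

Lemma labperm_subproof i :
  injective (fun p : {set gT} * G => (p.1 :* a i, p.2 * lam p.1 i)).
Proof.
move=> [u x] [v y] /= [/(can_inj (rcosetK _)) -> ] .
by move/mulIg->.
Qed.

(* The action of the wreath product: it makes the labels of paths with values
   in a finite group visible in a finite quotient of [F_k]. *)
Definition labperm i : {perm ({set gT} * G)} := perm (@labperm_subproof i).

Lemma weval_labperm s v x :
  weval labperm s (v, x) = (v :* weval a s, x * lab lam v s).
Proof.
elim: s v x => [|l s IHs] v x /=; first by rewrite perm1 !mulg1.
rewrite permM; have ->: leval labperm l (v, x) = (v :* leval a l, x * llab lam v l).
  rewrite /llab /leval; case: l => i [] /=; last by rewrite permE.
  apply: (canLR (permK _)); rewrite permE /=.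
  by rewrite -rcosetM mulVg mulg1 mulgKV.
by rewrite IHs rcosetM mulgA.
Qed.

End LabPerm.
End Labels.


(** * The graph traced by a word *)

Section SpanningTree.
Local Open Scope group_scope.
Variables (k : nat) (gT : finGroupType) (a : 'I_k -> gT).
Implicit Types (v : {set gT}) (l : letter k) (s : seq (letter k)).

Lemma edges_splitP v s e : e \in edges a v s ->
  exists s1 l s2, s = s1 ++ l :: s2 /\ e = edge a (v :* weval a s1) l.
Proof.
elim: s v => //= l s IHs v; rewrite inE => /orP[/eqP->|/IHs].
  by exists [::], l, s; rewrite /= mulg1.
by case=> s1 [l' [s2 [-> ->]]]; exists (l :: s1), l', s2; rewrite /= rcosetM.
Qed.

Definition verts v s := [seq v :* weval a (take p s) | p <- iota 0 (size s).+1].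

Lemma vertsP v s u :
  reflect (exists2 s1, prefix s1 s & u = v :* weval a s1) (u \in verts v s).
Proof.
apply: (iffP mapP) => [[p _ ->]|[s1]].
  by exists (take p s) => //; apply: prefix_take.
rewrite prefixE => /eqP <- ->; case: (leqP (size s1) (size s)) => Hp.
  by exists (size s1) => //; rewrite mem_iota ltnS.
by exists (size s); rewrite ?mem_iota ?ltnSn // !take_oversize // ltnW.
Qed.

Lemma edge_verts v s u i : (u, i) \in edges a v s ->
  u \in verts v s /\ u :* a i \in verts v s.
Proof.
case/edges_splitP=> s1 [l [s2 [def_s]]].
have p1: v :* weval a s1 \in verts v s.
  by apply/vertsP; exists s1; rewrite ?def_s ?prefix_prefix.
have p2: v :* weval a s1 :* leval a l \in verts v s.
  apply/vertsP; exists (rcons s1 l); first by rewrite def_s -cat_rcons prefix_prefix.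
  by rewrite weval_rcons rcosetM.
rewrite /edge /leval; case: l {def_s} p2 => j [] /= p2 [-> ->]; split=> //.
by rewrite -(rcosetM _ _^-1) mulVg mulg1.
Qed.

Lemma prefix_rconsE (T : eqType) (s1 s : seq T) x :
  prefix s1 (rcons s x) = (s1 == rcons s x) || prefix s1 s.
Proof.
elim: s s1 => [|y s IHs] [|z s1] //=.
  by rewrite eqseq_cons orbF; case: s1.
by rewrite IHs eqseq_cons andb_orr.
Qed.

Lemma verts_rcons v s l u :
  (u \in verts v (rcons s l)) = (u \in verts v s) || (u == v :* weval a (rcons s l)).
Proof.
apply/vertsP/orP => [[s1]|].
  rewrite prefix_rconsE => /orP[/eqP->|p1] ->; last by left; apply/vertsP; exists s1.
  by right.
case=> [/vertsP[s1 p1 ->]|/eqP->]; last by exists (rcons s l); rewrite ?prefix_refl.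
by exists s1; rewrite // prefix_rconsE p1 orbT.
Qed.

Lemma edges_rcons v s l :
  edges a v (rcons s l) = rcons (edges a v s) (edge a (v :* weval a s) l).
Proof. by rewrite -cats1 edges_cat /= cats1. Qed.

(* [S] is the edge set of a spanning tree of the graph traced by [s], and [t u]
   is the word read along the tree path from [v] to [u]. *)
Lemma spanning_tree v s :
  exists (t : {set gT} -> seq (letter k)) (S : {set {set gT} * 'I_k}),
  [/\ t v = [::],
      forall e, e \in S -> e \in edges a v s,
      forall u, u \in verts v s ->
        v :* weval a (t u) = u /\ {subset edges a v (t u) <= S}
    & forall u i, (u, i) \in S ->
        FG_of (t u) * FG_gen i = FG_of (t (u :* a i))].
Proof.
elim/last_ind: s => [|s l [t [S [tv SE tP tS]]]].
  exists (fun=> [::]), set0; split=> // [e|u|u i]; rewrite ?inE //=.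
  by move/eqP->; rewrite /= mulg1.
set u0 := v :* weval a s.
have u0s: u0 \in verts v s by apply/vertsP; exists s; rewrite ?prefix_refl.
(* An already visited endpoint leaves the tree unchanged; a new one is attached by the last edge. *)
case u1s: (v :* weval a (rcons s l) \in verts v s).
  exists t, S; split=> // [e eS|u].
    by rewrite edges_rcons mem_rcons inE SE ?orbT.
  by rewrite verts_rcons => /orP[/tP//|/eqP->]; apply: tP.
set u1 := v :* _ in u1s.
have u1E: u1 = u0 :* leval a l by rewrite /u1 weval_rcons rcosetM.
have neq u: u \in verts v s -> (u == u1) = false.
  by move=> us; apply: contraFF u1s => /eqP <-.
have [t0 St0] := tP _ u0s.
exists (fun u => if u == u1 then rcons (t u0) l else t u), (edge a u0 l |: S).
split.
- by rewrite neq //; apply/vertsP; exists [::]; rewrite ?prefix0s //= mulg1.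
- move=> e; rewrite !inE edges_rcons mem_rcons inE.
  by case/orP=> [->//|/SE->]; rewrite orbT.
- move=> u; rewrite verts_rcons -/u1.
  case: eqP => [-> _|_]; last first.
    rewrite orbF => /tP[-> sub]; split=> // e /sub.
    by rewrite !inE => ->; rewrite orbT.
  split; first by rewrite weval_rcons rcosetM t0.
  move=> e; rewrite edges_rcons t0 mem_rcons !inE.
  by case/orP=> [->//|/St0->]; rewrite orbT.
- move=> u i; rewrite !inE => /orP[|uiS]; last first.
    by have [us uis] := edge_verts (SE _ uiS); rewrite !neq // tS.
  have FG_rcons w l': FG_of (rcons w l') = FG_of w * FG_of [:: l'].
    by rewrite -cats1 FG_of_cat.
  (* The new edge starts at [u1] if the last letter is an inverse, and ends there otherwise. *)
  rewrite /edge -u1E; clearbody u1; case: l u1E {u1s} => j [] u1E /eqP[-> ->].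
    rewrite eqxx FG_rcons.
    have ->: u1 :* a j = u0.
      by rewrite u1E /leval /= -rcosetM mulVg mulg1.
    rewrite neq // -mulgA -[RHS]mulg1; congr (_ * _).
    exact: (mulVg (FG_gen j)).
  by rewrite neq // -[u0 :* a j]/(u0 :* leval a (j, false)) -u1E eqxx FG_rcons.
Qed.

End SpanningTree.

(** * Lifting traced paths to a stable refinement *)

Section Refinement.
Local Open Scope group_scope.
Variables (k : nat) (gT hT : finGroupType) (a : 'I_k -> gT) (b : 'I_k -> hT).
Variables (v : {set gT}) (v' : {set hT}) (s : seq (letter k)).
Hypothesis stable : forall s1 s2, prefix s1 s -> prefix s2 s ->
  v :* weval a s1 = v :* weval a s2 -> v' :* weval b s1 = v' :* weval b s2.

(** A map from coarse to fine visited vertices, kept as a relation; [stable] makes it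
    single-valued. *)
Definition corresp (u : {set gT}) (u' : {set hT}) :=
  exists2 s1, prefix s1 s & u = v :* weval a s1 /\ u' = v' :* weval b s1.

Lemma corresp_fun u u1 u2 : corresp u u1 -> corresp u u2 -> u1 = u2.
Proof.
move=> [s1 p1 [-> ->]] [s2 p2 [E ->]]; exact: stable.
Qed.

(** The edge occurs in [s] at some letter [l'], traversed by [l] in the same or the opposite
    direction. The prefixes ending before and after [l'] match its two endpoints, and uniqueness of
    matches identifies [u']. *)
Lemma corresp_step u u' l : corresp u u' -> edge a u l \in edges a v s ->
  corresp (u :* leval a l) (u' :* leval b l).
Proof.
move=> uu' /edges_splitP[s1 [l' [s2 [def_s]]]].
have c1: corresp (v :* weval a s1) (v' :* weval b s1).
  by exists s1; rewrite // def_s prefix_prefix.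
have c2: corresp (v :* weval a s1 :* leval a l') (v' :* weval b s1 :* leval b l').
  exists (rcons s1 l'); first by rewrite def_s -cat_rcons prefix_prefix.
  by rewrite !weval_rcons !rcosetM.
have same_sign: u = v :* weval a s1 -> l = l' ->
    corresp (u :* leval a l) (u' :* leval b l).
  by move=> eu el; subst; rewrite (corresp_fun uu' c1).
have opp_sign: u = v :* weval a s1 :* leval a l' -> l = letter_inv l' ->
    corresp (u :* leval a l) (u' :* leval b l).
  move=> eu el; subst; rewrite (corresp_fun uu' c2) !leval_inv.
  by rewrite -!(rcosetM _ (leval _ l')) !mulgV !mulg1.
rewrite /edge; case: l l' {def_s c1 c2} same_sign opp_sign => [i c] [j d] /=.
case: c; case: d => /= same_sign opp_sign [eu ei]; subst j.
- by apply: same_sign => //; apply: (can_inj (rcosetK _)) eu.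
- by apply: opp_sign => //; rewrite -eu /leval /= -rcosetM mulVg mulg1.
- by apply: opp_sign.
- exact: same_sign.
Qed.

Lemma corresp_path u u' r : corresp u u' ->
  {subset edges a u r <= edges a v s} ->
  corresp (u :* weval a r) (u' :* weval b r).
Proof.
elim: r u u' => [|l r IHr] u u' uu' sub /=; first by rewrite !mulg1.
rewrite !rcosetM; apply: IHr => [|e er].
  by apply: corresp_step => //; apply: sub; rewrite mem_head.
by apply: sub; rewrite inE er orbT.
Qed.

Lemma corresp_refl : corresp v v'.
Proof. by exists [::]; rewrite ?prefix0s //= !mulg1. Qed.

End Refinement.


(** * Finite quotients and elements of the completion *)

Section FiniteImages.
Local Open Scope group_scope.

(** Inverses need no clause: in a finite group they are positive products. *)
Lemma gen_ind (gT : finGroupType) (A : {set gT}) (P : gT -> Prop) :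
  P 1 -> (forall x y, P x -> P y -> P (x * y)) ->
  (forall x, x \in A -> P x) -> forall x, x \in <<A>> -> P x.
Proof.
move=> P1 PM PA x /gen_prodgP[r [c cA ->]].
by apply: (big_ind P) => // i _; apply: PA.
Qed.

Lemma lab_morph k (gT : finGroupType) (a : 'I_k -> gT) (G H : groupType)
    (lam : {set gT} -> 'I_k -> G) (f : G -> H) v s :
  {morph f : x y / x * y} ->
  f (lab a lam v s) = lab a (fun u i => f (lam u i)) v s.
Proof.
move=> fM; have f1 := mulmap1 fM.
have fV := mulmapV fM.
elim: s v => //= l s IHs v; rewrite fM IHs /llab.
by case: l.2; rewrite ?fV.
Qed.

Variable k : nat.

Section Image.
Variables (gT : finGroupType) (a : 'I_k -> gT).

Definition img : {group gT} := <<[set a i | i : 'I_k]>>%G.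

Lemma weval_img s : weval a s \in img.
Proof.
elim: s => [|l s IHs] /=; first exact: group1.
apply: groupM => //; rewrite /leval; case: l.2; rewrite ?groupV;
  by apply: mem_gen; apply: imset_f.
Qed.

Lemma img_FG_hom x : x \in img -> exists u, FG_hom a u = x.
Proof.
apply: (gen_ind (P := fun x => exists u, FG_hom a u = x)).
- by exists 1.
- by move=> _ _ [u <-] [u' <-]; exists (u * u'); rewrite FG_homM.
- move=> _ /imsetP[i _ ->]; exists (FG_gen i).
  by rewrite FG_hom_of /= mulg1.
Qed.

Definition to_img (u : FG k) : subg_of img := subg img (FG_hom a u).

Lemma to_imgK u : sgval (to_img u) = FG_hom a u.
Proof. by rewrite subgK // weval_img. Qed.

Lemma to_img_surj : is_surj_hom to_img.
Proof.
split=> [x y|h].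
  apply: val_inj; rewrite /= -/(to_img _) to_imgK.
  by rewrite !to_imgK -FG_homM.
have [u def_h] := img_FG_hom (subgP h).
by exists u; apply: val_inj; apply: etrans (to_imgK u) def_h.
Qed.

(** Indices are surjections, so the homomorphism given by [a] is corestricted to its image. *)
Definition img_idx : Idx k :=
  existT _ (subg_of img : finGroupType) (exist _ to_img to_img_surj).

End Image.

Variables (n : nat) (x : 'I_n -> Prod k).
Hypothesis x_hat : forall j, in_hat (x j).

(** The value at [x j] of the continuous extension to the completion of the homomorphism given by
    [a]. *)
Definition hval (gT : finGroupType) (a : 'I_k -> gT) j : gT :=
  sgval (x j (img_idx a)).

Lemma hat_approx (S : list (Idx k)) : exists h : 'I_n -> FG k,
  forall i, List.In i S -> forall j, proj i (h j) = x j i.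
Proof.
have [h hP] := fin_all_exists (fun j => x_hat j S).
by exists h => i iS j; apply: hP.
Qed.

Lemma hval_proj (gT : finGroupType) (a : 'I_k -> gT) j u :
  proj (img_idx a) u = x j (img_idx a) -> FG_hom a u = hval a j.
Proof. by rewrite /hval => <-; rewrite to_imgK. Qed.

Lemma hval_approx (gT hT : finGroupType) (a : 'I_k -> gT) (b : 'I_k -> hT) :
  exists h : 'I_n -> FG k,
    forall j, FG_hom a (h j) = hval a j /\ FG_hom b (h j) = hval b j.
Proof.
have [h hP] := hat_approx [:: img_idx a; img_idx b].
exists h => j; split; apply: hval_proj; apply: hP; first by left.
by right; left.
Qed.

Definition hgrp (gT : finGroupType) (a : 'I_k -> gT) : {group gT} :=
  <<[set hval a j | j : 'I_n]>>%G.

Lemma hval_hgrp (gT : finGroupType) (a : 'I_k -> gT) j : hval a j \in hgrp a.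
Proof. by apply: mem_gen; apply: imset_f. Qed.

Section Morph.
Variables (gT hT : finGroupType) (a : 'I_k -> gT) (b : 'I_k -> hT).
Variable f : hT -> gT.
Hypotheses (fM : {morph f : x y / x * y}) (fab : f \o b =1 a).

Lemma weval_fab s : f (weval b s) = weval a s.
Proof. by rewrite (weval_morph _ fM); apply: eq_weval. Qed.

(** Points of [Prod k] carry no compatibility between coordinates; it comes from [x_hat], through
    one element of [FG k] that realises both coordinates. *)
Lemma hval_morph j : f (hval b j) = hval a j.
Proof.
by have [h hP] := hval_approx a b; have [<- <-] := hP j; apply: weval_fab.
Qed.

Lemma hgrp_morph z : z \in hgrp b -> f z \in hgrp a.
Proof.
apply: (gen_ind (P := fun z => f z \in hgrp a)) => [|u u' Hu Hu'|_ /imsetP[j _ ->]].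
- by rewrite (mulmap1 fM) group1.
- by rewrite fM groupM.
- by rewrite hval_morph hval_hgrp.
Qed.

Lemma hgrp_coset_morph s1 s2 :
  hgrp b :* weval b s1 = hgrp b :* weval b s2 ->
  hgrp a :* weval a s1 = hgrp a :* weval a s2.
Proof.
move/rcoset_eqP; rewrite mem_rcoset -weval_inv -weval_cat => /hgrp_morph.
by rewrite weval_fab weval_cat weval_inv -mem_rcoset => /rcoset_eqP.
Qed.

End Morph.

Variables (w : FG n) (g : FG k).
Hypothesis xw : forall i, peval x w i = diag g i.

Lemma hval_w (gT : finGroupType) (a : 'I_k -> gT) :
  FG_hom (hval a) w = FG_hom a g.
Proof.
have := congr1 sgval (xw (img_idx a)).
rewrite /diag /proj /= to_imgK => <-.
by rewrite /peval gevalE FG_hom_comp.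
Qed.

(** The image of [g] is [w] evaluated at the generators of [hgrp a], so the path of [g] closes. *)
Lemma hgrp_g (gT : finGroupType) (a : 'I_k -> gT) :
  hgrp a :* FG_hom a g = hgrp a.
Proof.
apply: rcoset_id; rewrite -hval_w /FG_hom; elim: (val w) => //= l s IHs.
by rewrite groupM // /leval; case: l.2; rewrite ?groupV hval_hgrp.
Qed.

(** * Carrying a solution through a labelling *)

Section Push.
Variables (gT : finGroupType) (a : 'I_k -> gT) (m : nat).
Variable lam : {set gT} -> 'I_k -> FG m.

Definition push_gen (i : Idx m) :=
  labperm a (fun v j => proj i (lam v j)).

(** The continuous extension of [lab] from the base vertex, applied to [x j]: the permutation moves
    the base point with label 1 to a point whose second component is the label of the path. *)
Definition push j : Prod m := fun i =>
  (hval (push_gen i) j (gval (hgrp a), 1)).2.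

Lemma projM (i : Idx m) : {morph proj i : u v / u * v}.
Proof. by case: i => gT' [f [fM fS]] u v; apply: fM. Qed.

Lemma push_proj i h :
  proj i (lab a lam (hgrp a) (val h)) =
    (FG_hom (push_gen i) h (gval (hgrp a), 1)).2.
Proof. by rewrite (lab_morph _ _ _ _ (projM i)) weval_labperm /= mul1g. Qed.

Lemma push_hat j : in_hat (push j).
Proof.
move=> S; have [h hP] := hat_approx (List.map (fun i => img_idx (push_gen i)) S).
exists (lab a lam (hgrp a) (val (h j))) => i iS.
rewrite push_proj /push -(@hval_proj _ _ _ (h j)) //.
by apply: hP; apply: (List.in_map (fun i => img_idx (push_gen i))).
Qed.

(** Replace the [x j] by words [h j] exact in two quotients: [a] makes their paths close, so that
    labels commute with [w], and [push_gen i] determines the labels modulo [i]. *)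
Lemma push_w i : peval push w i = diag (lab a lam (hgrp a) (val g) : FG m) i.
Proof.
have [h hP] := hval_approx a (push_gen i).
have fix_h j : hgrp a :* FG_hom a (h j) = hgrp a.
  by have [-> _] := hP j; rewrite rcoset_id ?hval_hgrp.
have ->: peval push w i =
    FG_hom (proj i \o (fun j => lab a lam (hgrp a) (val (h j)))) w.
  rewrite /peval gevalE; apply: eq_FG_hom => j /=.
  by rewrite push_proj (proj2 (hP j)).
rewrite -(FG_hom_comp _ _ (projM i)) -lab_FG_hom // push_proj.
rewrite /diag push_proj -hval_w FG_hom_comp; last exact: FG_homM.
have E: FG_hom (push_gen i) \o h =1 hval (push_gen i).
  by move=> j; rewrite -(proj2 (hP j)).
by rewrite (eq_FG_hom w E).
Qed.

End Push.
End FiniteImages.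


(** * Retraction onto the fundamental group of the traced graph *)

Section Retraction.
Local Open Scope group_scope.
Variables (k : nat) (gT : finGroupType) (a : 'I_k -> gT).
Variables (v0 : {set gT}) (s : seq (letter k)).
Variables (t : {set gT} -> seq (letter k)) (S : {set {set gT} * 'I_k}).
Hypotheses (t_v0 : t v0 = [::]) (SE : forall e, e \in S -> e \in edges a v0 s).
Hypothesis tP : forall u, u \in verts a v0 s ->
  v0 :* weval a (t u) = u /\ {subset edges a v0 (t u) <= S}.
Hypothesis tS : forall u i, (u, i) \in S ->
  FG_of (t u) * FG_gen i = FG_of (t (u :* a i)).

Definition cotree : {set {set gT} * 'I_k} :=
  [set e | (e \in edges a v0 s) && (e \notin S)].

(** The default 1 covers tree edges and also edges that [s] never traces. With free generators as
    [gen], labels of closed paths give the retraction onto the fundamental group; other targets give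
    its quotients. *)
Definition cotree_lab (G : groupType) (gen : 'I_#|cotree| -> G) u i : G :=
  if [pick c | enum_val c == (u, i)] is Some c then gen c else 1.

(** The fundamental cycle of a cotree edge; these cycles form the basis of the fundamental group. *)
Definition chord (c : 'I_#|cotree|) : seq (letter k) :=
  let: (u, i) := enum_val c in t u ++ (i, false) :: word_inv (t (u :* a i)).

Definition chord_hom : FG #|cotree| -> FG k := FG_hom (fun c => FG_of (chord c)).

Lemma chord_homM : {morph chord_hom : x y / x * y}.
Proof. exact: FG_homM. Qed.

Variant cotree_lab_spec (G : groupType) (gen : 'I_#|cotree| -> G) u i : G -> Prop :=
  | CotreeLabIn (c : 'I_#|cotree|) of enum_val c = (u, i) : cotree_lab_spec gen u i (gen c)
  | CotreeLabOut of (u, i) \notin cotree : cotree_lab_spec gen u i 1.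

Lemma cotree_labP (G : groupType) (gen : 'I_#|cotree| -> G) u i :
  cotree_lab_spec gen u i (cotree_lab gen u i).
Proof.
rewrite /cotree_lab; case: pickP => [c /eqP Ec|none]; first by constructor.
constructor; apply/negP => uiT.
by have := none (enum_rank_in uiT (u, i)); rewrite enum_rankK_in ?eqxx.
Qed.

Lemma cotree_lab_tree (G : groupType) (gen : 'I_#|cotree| -> G) u :
  u \in verts a v0 s -> lab a (cotree_lab gen) v0 (t u) = 1.
Proof.
move=> us; have [_ sub] := tP us; apply: lab_eq1 => u' i /sub uiS.
case: cotree_labP => // c Ec; have := enum_valP c.
by rewrite Ec inE uiS andbF.
Qed.

Lemma chordP (c : 'I_#|cotree|) : exists u i, [/\ enum_val c = (u, i), (u, i) \in edges a v0 s,
  u \in verts a v0 s & u :* a i \in verts a v0 s].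
Proof.
have := enum_valP c; case: (enum_val c) => u i; rewrite inE => /andP[uiE _].
by exists u, i; have [] := edge_verts uiE.
Qed.

Lemma lab_chord (G : groupType) (gen : 'I_#|cotree| -> G) c :
  lab a (cotree_lab gen) v0 (chord c) = gen c.
Proof.
have [u [i [Ec _ us uis]]] := chordP c; rewrite /chord Ec lab_cat /=.
rewrite cotree_lab_tree // mul1g (proj1 (tP us)).
have -> : leval a (i, false) = a i by [].
rewrite -{1}(proj1 (tP uis)) lab_inv cotree_lab_tree // invg1 mulg1.
rewrite /llab /=; case: cotree_labP => [c'|].
  by rewrite -Ec => /enum_val_inj->.
by rewrite -Ec enum_valP.
Qed.

(** On every traced edge the label maps to [t(u) x_i t(u x_i)^-1], which is trivial on tree edges by
    [tS]. The product telescopes, and [t v0] is empty. *)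
Lemma chord_homK : v0 :* weval a s = v0 ->
  chord_hom (lab a (cotree_lab (@FG_gen _)) v0 s) = FG_of s.
Proof.
move=> v0s; rewrite (lab_telescope (b := @FG_gen k) (t := fun u => FG_of (t u)) chord_homM).
  rewrite v0s t_v0 weval_gen.
  have -> : FG_of [::] = 1 :> FG k by exact: val_inj.
  by rewrite mul1g invg1 mulg1.
move=> u i uiE; case: cotree_labP => [c Ec|].
  rewrite /chord_hom FG_hom_of /= mulg1 /leval /= /chord Ec.
  by rewrite -cat_rcons FG_of_cat FG_of_inv -cats1 FG_of_cat.
by rewrite inE uiE negbK => /tS->; rewrite mulgV.
Qed.

(** A chord uses traced edges only, so it lifts to the refinement; there the lifted edge still joins
    the ends of the two lifted tree paths. *)
Lemma chord_closed (hT : finGroupType) (b : 'I_k -> hT) (v' : {set hT}) c :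
  (forall s1 s2, prefix s1 s -> prefix s2 s ->
     v0 :* weval a s1 = v0 :* weval a s2 -> v' :* weval b s1 = v' :* weval b s2) ->
  v' :* weval b (chord c) = v'.
Proof.
move=> stable; have [u [i [Ec uiE us uis]]] := chordP c.
have tree u' : u' \in verts a v0 s ->
    corresp a b v0 v' s u' (v' :* weval b (t u')).
  move=> u's; have [tu sub] := tP u's; rewrite -{1}tu.
  apply: (corresp_path stable) => [|e /sub/SE //]; exact: corresp_refl.
have := corresp_step (l := (i, false)) stable (tree _ us) uiE.
move/(corresp_fun stable)/(_ (tree _ uis)) => E.
rewrite /chord Ec -cat_rcons weval_cat weval_rcons weval_inv !rcosetM E.
by rewrite -rcosetM mulgV mulg1.
Qed.

End Retraction.

(** * Rank bound and descent through refinements *)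

Section Descent.
Local Open Scope group_scope.
Variables (n k : nat) (w : FG n) (g : FG k) (x : 'I_n -> Prod k).
Hypotheses (x_hat : forall j, in_hat (x j)).
Hypothesis xw : forall i, peval x w i = diag g i.
Hypothesis lg : forall m, (1 <= m)%N -> (m <= n)%N -> local_to_global w m.

Let s := val g.
Let L := size s.

(** The measure of the descent: pairs of positions at which the path of [g] meets the same vertex. A
    word of length [L] has [L.+1] positions. *)
Definition collisions (gT : finGroupType) (a : 'I_k -> gT) :=
  [set p : 'I_L.+1 * 'I_L.+1 |
    hgrp x a :* weval a (take p.1 s) == hgrp x a :* weval a (take p.2 s)].

(** Multiplication of labels is addition of rows here. The quotient [b] sees both vertices and
    labels, so labels of elements of its subgroup [hgrp x b] lie in the span of the [n] labels of
    the [x j]. The [c i] put a basis of dimension [m] in that span. *)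
Lemma rank_bound (gT : finGroupType) (a : 'I_k -> gT) m
    (lam : {set gT} -> 'I_k -> 'rV['F_2]_m) (c : 'I_m -> seq (letter k)) :
  (forall i, lab a lam (hgrp x a) (c i) = delta_mx 0%R i) ->
  (forall i, weval (fun j => (a j, labperm a lam j)) (c i) \in
     hgrp x (fun j => (a j, labperm a lam j))) ->
  (m <= n)%N.
Proof.
set b := fun j => _ => lab_c b_c.
have [h hP] := hval_approx x_hat a b.
pose M : 'M['F_2]_(n, m) :=
  (\matrix_(j < n) (lab a lam (hgrp x a) (val (h j)) : 'rV_m))%R.
have b_fst u : (weval b u).1 = weval a u by exact: (@weval_morph _ _ _ b fst).
have b_snd u : (weval b u).2 = weval (labperm a lam) u.
  exact: (@weval_morph _ _ _ b snd).
(* Closing at the base is part of the invariant because labels read from the base add up only for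
   closed paths. *)
pose P z := exists u : FG k,
    [/\ FG_hom b u = z, hgrp x a :* FG_hom a u = hgrp x a
      & (lab a lam (hgrp x a) (val u) <= M)%MS].
have spanned z : z \in hgrp x b -> P z.
  apply: (gen_ind (P := P)) => [|_ _ [u [<- ua uM]] [u' [<- ua' uM']]|_ /imsetP[j _ ->]].
  - exists 1; split=> //; first by rewrite /FG_hom /= mulg1.
    exact: sub0mx.
  - exists (u * u'); split; first by rewrite FG_homM.
      by rewrite FG_homM rcosetM ua.
    rewrite lab_reduce lab_cat -/(FG_hom a u) ua; exact: addmx_sub.
  - have [aj bj] := hP j; exists (h j); split=> //.
      by rewrite aj rcoset_id ?hval_hgrp.
    by rewrite -(rowK (fun j => lab a lam (hgrp x a) (val (h j)) : 'rV_m) j) row_sub.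
have: ((1%:M)%R <= M)%MS.
  apply/row_subP => i; rewrite row1 -lab_c.
  have [u [bu _]] := spanned _ (b_c i).
  have -> // : lab a lam (hgrp x a) (val u) = lab a lam (hgrp x a) (c i).
  have /(congr1 (fun z => ((z.2 : {perm _}) (gval (hgrp x a), 1)).2)) := bu.
  by rewrite /FG_hom !b_snd !weval_labperm /= !mul1g.
by move/mxrankS; rewrite mxrank1 => /leq_trans; apply; apply: rank_leq_row.
Qed.

(** Refine [a] by the mod 2 labels of its own traced graph. Either a collision disappears, or the
    graph is stable, its rank is at most [n], and a solution in the free group on its chords maps
    back to [FG k]. *)
Lemma collisions_drop (gT : finGroupType) (a : 'I_k -> gT) :
  (exists gs : 'I_n -> FG k, feval gs w = g) \/
  exists (hT : finGroupType) (b : 'I_k -> hT),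
    (#|collisions b| < #|collisions a|)%N.
Proof.
set v0 := gval (hgrp x a).
have [t [S [t_v0 SE tP tS]]] := spanning_tree a v0 s.
set m := #|cotree a v0 s S|.
pose lam := cotree_lab (fun c : 'I_m => delta_mx 0%R c : 'rV['F_2]_m).
pose b j := (a j, labperm a lam j).
have sub: collisions b \subset collisions a.
  apply/subsetP => p; rewrite !inE => /eqP E; apply/eqP.
  exact: (@hgrp_coset_morph _ _ _ x_hat _ _ a b fst).
have [eq_col|neq_col] := eqVneq (collisions b) (collisions a); last first.
  right; exists _, b; rewrite proper_card // properEneq neq_col //.
left; have stable s1 s2 : prefix s1 s -> prefix s2 s ->
    v0 :* weval a s1 = v0 :* weval a s2 ->
    hgrp x b :* weval b s1 = hgrp x b :* weval b s2.
  move=> p1 p2 /eqP E.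
  have lt1: (size s1 < L.+1)%N by rewrite ltnS size_prefix.
  have lt2: (size s2 < L.+1)%N by rewrite ltnS size_prefix.
  have := in_setT (Ordinal lt1, Ordinal lt2).
  move/setP/(_ (Ordinal lt1, Ordinal lt2)): eq_col; rewrite !inE /=.
  move: p1 p2; rewrite !prefixE => /eqP-> /eqP->.
  by rewrite E => /eqP.
have m_le_n: (m <= n)%N.
  apply: (@rank_bound _ a m lam (@chord _ _ a v0 s t S)) => c.
    exact: lab_chord.
  (* A path that closes at the coset [hgrp x b] has its image in that subgroup. *)
  have := rcoset_refl (hgrp x b) (weval b (chord t c)).
  by rewrite (chord_closed SE tP c stable).
pose g' : FG m := lab a (cotree_lab (@FG_gen m)) v0 s.
have g'K : chord_hom t g' = g.
  rewrite chord_homK ?FG_ofK //; exact: hgrp_g.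
have [gs' gs'w] : exists gs' : 'I_n -> FG m, feval gs' w = g'.
  (* The hypothesis [lg] starts at rank 1; in rank 0 the empty word is the only element. *)
  have [m0|m_gt0] := posnP m.
    exists (fun=> 1); apply: val_inj.
    have nil (y : FG m) : val y = [::].
      by case: (val y) => // -[[i lt_i] c] r; exfalso; have := lt_i; rewrite m0.
    by rewrite !nil.
  apply/(lg m_gt0 m_le_n g'); exists (push x a (cotree_lab (@FG_gen m))).
  split=> [j|i]; first exact: push_hat.
  exact: push_w.
exists (fun j => chord_hom t (gs' j)).
rewrite -g'K -gs'w !fevalE; symmetry; apply: FG_hom_comp; exact: chord_homM.
Qed.

Lemma solvable_of_hat_solvable : exists gs : 'I_n -> FG k, feval gs w = g.
Proof.
suff H N : forall (gT : finGroupType) (a : 'I_k -> gT),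
    (#|collisions a| < N)%N -> exists gs : 'I_n -> FG k, feval gs w = g.
  (* The descent may start at any finite quotient; this one has trivial image. *)
  exact: (H _ _ (fun=> 1 : {perm bool}) (ltnSn _)).
elim: N => // N IHN gT a lt_aN.
have [//|[hT [b lt_ba]]] := collisions_drop a.
by apply: (IHN hT b); apply: leq_trans lt_ba _.
Qed.

End Descent.

(** * The equivalence *)

Lemma hat_solvable_feval n k (w : FG n) (gs : 'I_n -> FG k) :
  exists xs : 'I_n -> Prod k, (forall j, in_hat (xs j)) /\
    (forall i, peval xs w i = diag (feval gs w) i).
Proof.
exists (fun j => diag (gs j)); split=> [j S|i]; first by exists (gs j).
by rewrite /diag fevalE (FG_hom_comp _ _ (projM i)).
Qed.

Theorem mainTheorem2 (n : nat) (hn : 1 <= n) (w : FG n) :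
  (forall k : nat, 1 <= k -> local_to_global w k) <->
  (forall k : nat, 1 <= k -> k <= n -> local_to_global w k).
Proof.
split=> [lg k k_gt0 _|lg k k_gt0 g]; first exact: lg.
split=> [[x [x_hat xw]]|[gs <-]]; first exact: solvable_of_hat_solvable xw lg.
exact: hat_solvable_feval.
Qed.
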